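(* For all integers $k,n,m\geqslant 0$, the poset $\Sigma^k_n C^n_m$ is isomorphic to the subposet of $C^n_{k+m}$ consisting of those elements $(x_1,\dots,x_n)$ satisfying the condition: for each $i\in\{1,\dots,n-1\}$, if $x_{i+1}\in\{0,\dots,k-1\}$ then $x_i\leqslant x_{i+1}$. Moreover, this subposet is a sublattice of $C^n_{k+m}$.
   Context: For $r\geqslant 0$, $C_r$ is the chain $\{0<1<\dots<r\}$ and $C_r^n$ its $n$-th cartesian power with componentwise order (a lattice with componentwise min and max). Stacking (lax sum): given a sequence of posets $M_0,M_1,M_2,\dots$ with monotone maps $f_j\colon M_j\to M_{j+1}$, the poset $\Sigma_nM_n$ has elements the pairs $(x,j)$ with $0\leqslant j\leqslant n$, $x\in M_j$, ordered by $(x,j)\leqslant(y,k)$ iff $j\leqslant k$ and $(f_{k-1}\circ\dots\circ f_j)(x)\leqslant y$ in $M_k$ (identity composite when $j=k$). The maps $f'_n\colon\Sigma_nM_n\to\Sigma_{n+1}M_{n+1}$, $(x,j)\mapsto(x,j)$, make $(\Sigma_nM_n)_{n\geqslant0}$ again such a sequence. Iterated stacking: $\Sigma^0_nM_n=M_n$ and $\Sigma^{k}_nM_n$ is the stacking of the sequence $(\Sigma^{k-1}_nM_n)_{n\geqslant 0}$ with the maps just described. $\Sigma^k_nC^n_m$ denotes the $k$-iterated stacking of the sequence $C^0_m\to C^1_m\to C^2_m\to\dots$ with maps $(x_1,\dots,x_i)\mapsto(0,x_1,\dots,x_i)$. *)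

(* Defs.v *)
From HB Require Import structures.
From mathcomp Require Import all_boot all_order.

Set Implicit Arguments.
Unset Strict Implicit.
Unset Printing Implicit Defensive.

Import Order.TTheory.
Local Open Scope order_scope.

Definition poset_iso d d' (P : porderType d) (Q : porderType d') : Prop :=
  exists2 f : P -> Q, bijective f & {mono f : x y / x <= y}.

Definition sublattice d (L : latticeType d) (S : {pred L}) : Prop :=
  Order.ClosedPredicates.meet_closed S /\ Order.ClosedPredicates.join_closed S.

Record poset_seq (d : Order.disp_t) := PosetSeq {
  pobj :> nat -> porderType d;
  pstep : forall n, pobj n -> pobj n.+1;
  pstep_homo : forall n, {homo @pstep n : x y / x <= y}
}.
Arguments pstep {d} M n x : rename.

Section Stacking.
Variables (d : Order.disp_t) (M : poset_seq d).

Fixpoint push (i j : nat) (x : M j) : M (i + j)%N :=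
  if i is i'.+1 return M (i + j)%N then pstep M (i' + j) (push i' x) else x.

(* The composite f_(k-1) o ... o f_j; the cast is along k - j + j = k. *)
Definition push_to (j k : nat) (le_jk : (j <= k)%N) (x : M j) : M k :=
  ecast l (M l) (subnK le_jk) (push (k - j) x).

(* The pair (x, j) is represented with its level j first. *)
Definition stacking (n : nat) : Type := {j : 'I_n.+1 & M j}.

HB.instance Definition _ n := Choice.on (stacking n).

Definition stack_elt n (j : 'I_n.+1) (x : M j) : stacking n :=
  Tagged (fun j : 'I_n.+1 => M j) x.

Definition le_stacking n (u v : stacking n) : bool :=
  if @idP (tag u <= tag v)%N is ReflectT le_uv
  then push_to le_uv (tagged u) <= tagged v else false.

Lemma le_stackingP n (u v : stacking n) :
  reflect (exists le_uv : (tag u <= tag v)%N,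
             push_to le_uv (tagged u) <= tagged v)
          (le_stacking u v).
Proof.
rewrite /le_stacking; case: {-}_ / idP => [le_uv|nle_uv]; last first.
  by right=> -[le_uv _]; apply: nle_uv.
apply: (iffP idP) => [le_p|[le_uv' le_p]]; first by exists le_uv.
by rewrite (bool_irrelevance le_uv le_uv').
Qed.

Lemma push_toE j k (le_jk : (j <= k)%N) (x : M j) i (e : (i + j)%N = k) :
  push_to le_jk x = ecast l (M l) e (push i x).
Proof.
rewrite /push_to; move: (subnK le_jk).
have -> : (k - j)%N = i by rewrite -e addnK.
by move=> e'; rewrite (eq_irrelevance e e').
Qed.

Lemma push_to_id j (le_jj : (j <= j)%N) (x : M j) : push_to le_jj x = x.
Proof. exact: (@push_toE j j le_jj x 0 erefl). Qed.

Lemma push_toS j k (le_jk : (j <= k)%N) (le_jk1 : (j <= k.+1)%N) (x : M j) :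
  push_to le_jk1 x = pstep M k (push_to le_jk x).
Proof.
rewrite (@push_toE _ _ _ x (k - j).+1 (congr1 S (subnK le_jk))) /push_to.
by move: (k - j)%N (subnK le_jk) => i e; subst k.
Qed.

Lemma push_to_trans j k l (le_jk : (j <= k)%N) (le_kl : (k <= l)%N)
    (le_jl : (j <= l)%N) (x : M j) :
  push_to le_kl (push_to le_jk x) = push_to le_jl x.
Proof.
elim: l le_kl le_jl => [|l IHl] le_kl le_jl.
  have k0 : k = 0%N by apply/eqP; rewrite -leqn0.
  by subst k; rewrite push_to_id (bool_irrelevance le_jk le_jl).
have [lt_kl|] := boolP (k <= l)%N; last first.
  rewrite -ltnNge => lt_lk; have kl : k = l.+1 by apply/eqP; rewrite eqn_leq le_kl.
  by subst k; rewrite push_to_id (bool_irrelevance le_jk le_jl).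
have le_jl' := leq_trans le_jk lt_kl.
by rewrite (push_toS lt_kl) (push_toS le_jl') (IHl _ le_jl').
Qed.

Lemma push_to_homo j k (le_jk : (j <= k)%N) :
  {homo push_to le_jk : x y / x <= y}.
Proof.
elim: k le_jk => [|k IHk] le_jk x y le_xy.
  have j0 : j = 0%N by apply/eqP; rewrite -leqn0.
  by subst j; rewrite !push_to_id.
have [le_jk'|] := boolP (j <= k)%N; last first.
  rewrite -ltnNge => lt_kj; have jk : j = k.+1 by apply/eqP; rewrite eqn_leq le_jk.
  by subst j; rewrite !push_to_id.
by rewrite !(push_toS le_jk'); apply/pstep_homo/IHk.
Qed.

Fact le_stacking_refl n : reflexive (@le_stacking n).
Proof. by move=> u; apply/le_stackingP; exists (leqnn _); rewrite push_to_id. Qed.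

Fact le_stacking_anti n : antisymmetric (@le_stacking n).
Proof.
move=> [j x] [k y] /andP[/le_stackingP[/= le_jk le_xy] /le_stackingP[/= le_kj]].
have jk : j = k by apply/val_inj/eqP; rewrite eqn_leq le_jk.
subst k; move: le_xy; rewrite !push_to_id => le_xy le_yx.
by congr (existT _ _ _); apply/le_anti; rewrite le_xy.
Qed.

Fact le_stacking_trans n : transitive (@le_stacking n).
Proof.
move=> [k y] [j x] [l z] /le_stackingP[/= le_jk le_xy] /le_stackingP[/= le_kl le_yz].
apply/le_stackingP => /=; exists (leq_trans le_jk le_kl).
rewrite -(push_to_trans le_jk le_kl); apply: le_trans le_yz.
exact: push_to_homo.
Qed.

HB.instance Definition _ n := Order.Le_isPOrder.Build d (stacking n)
  (@le_stacking_refl n) (@le_stacking_anti n) (@le_stacking_trans n).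

Definition stacking_map n (u : stacking n) : stacking n.+1 :=
  @stack_elt n.+1 (widen_ord (leqnSn n.+1) (tag u)) (tagged u).

Fact stacking_map_homo n : {homo @stacking_map n : u v / u <= v}.
Proof. by []. Qed.

Definition stack : poset_seq d :=
  @PosetSeq d (fun n => stacking n) stacking_map stacking_map_homo.

End Stacking.

Fixpoint iter_stack d (k : nat) (M : poset_seq d) : poset_seq d :=
  if k is k'.+1 then stack (iter_stack k' M) else M.

Notation chain_pow r n := (n.-tupleprod 'I_r.+1).

Definition pad0 (r n : nat) (x : chain_pow r n) : chain_pow r n.+1 :=
  [tuple of ord0 :: x].

Fact pad0_homo r n : {homo @pad0 r n : x y / x <= y}.
Proof.
move=> x y; rewrite !leEtprod => /forallP le_xy; apply/forallP => i.
by case: (unliftP ord0 i) => [j|] ->; rewrite ?tnthS ?tnth0.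
Qed.

Definition chain_pow_seq (m : nat) :=
  @PosetSeq _ (fun n => chain_pow m n) (@pad0 m) (@pad0_homo m).

(* Coordinates are numbered from 0 here, so tnth x i is x_(i+1); s is the
   position following i. *)
Definition slope_cond (k r n : nat) : {pred chain_pow r n} :=
  [pred x : chain_pow r n | [forall i : 'I_n, forall s : 'I_n,
     (s == i.+1 :> nat) ==> (tnth x s < k)%N ==> (tnth x i <= tnth x s)]].
Arguments slope_cond : clear implicits.

Definition slope_poset (k r n : nat) : Type := {x : chain_pow r n | x \in slope_cond k r n}.

HB.instance Definition _ k r n := SubChoice.on (slope_poset k r n).
HB.instance Definition _ k r n :=
  [SubChoice_isSubPOrder of slope_poset k r n by <:
     with Order.seqprod_display preorder.Order.OrdinalOrder.ord_display].

(* Main.v *)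
Require Import Defs.
From mathcomp Require Import all_boot all_order.
From mathcomp Require Import zify.

Set Implicit Arguments.
Unset Strict Implicit.
Unset Printing Implicit Defensive.

Import Order.TTheory.

(** A word satisfying the condition for [k + 1] has all its zeros at the front,
    since [x_(i+1) = 0] forces [x_i = 0]; hence it is uniquely
    [0^(n-j) (y_1 + 1) ... (y_j + 1)] with [y] a word of length [j] satisfying
    the condition for [k].  So [(y, j) |-> 0^(n-j) (y + 1)] identifies one
    stacking of the posets for [k] with the posets for [k + 1], and it turns the
    transition maps again into padding by [0], which lets the induction on [k]
    proceed.  Words are sequences of natural numbers, so that elements of
    different levels live in a single ordered type.

    The sublattice property is local: the relation
    [x_(i+1) < k -> x_i <= x_(i+1)] between neighbouring coordinates is
    preserved by componentwise [min] and [max]. *)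

Definition order_embeds_onto d d' (T : porderType d') (W : T -> Prop)
    (P : porderType d) (f : P -> T) : Prop :=
  {mono f : x y / (x <= y)%O} /\ forall t, W t <-> exists x, f x = t.

Lemma eq_order_embeds_onto d d' (T : porderType d') (W W' : T -> Prop)
    (P : porderType d) (f : P -> T) :
  (forall t, W t <-> W' t) -> order_embeds_onto W f -> order_embeds_onto W' f.
Proof. by move=> eqW [f_mono f_im]; split=> // t; rewrite -eqW. Qed.

Lemma order_embeds_onto_lift d d1 d2 (T : porderType d) (W : T -> Prop)
    (P : porderType d1) (Q : porderType d2) (f : P -> T) (g : Q -> T) :
    order_embeds_onto W f -> order_embeds_onto W g ->
  exists h : P -> Q, forall x, g (h x) = f x.
Proof.
move=> [_ f_im] [_ g_im].
have lift x : exists y, g y == f x.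
  have /g_im[y <-] : W (f x) by apply/f_im; exists x.
  by exists y.
by exists (fun x => xchoose (lift x)) => x; apply/eqP/(xchooseP (lift x)).
Qed.

Lemma poset_iso_embeds_onto d d1 d2 (T : porderType d) (W : T -> Prop)
    (P : porderType d1) (Q : porderType d2) (f : P -> T) (g : Q -> T) :
  order_embeds_onto W f -> order_embeds_onto W g -> poset_iso P Q.
Proof.
move=> f_onto g_onto.
have [h gh] := order_embeds_onto_lift f_onto g_onto.
have [h' fh'] := order_embeds_onto_lift g_onto f_onto.
case: f_onto g_onto => [f_mono _] [g_mono _].
exists h; last by move=> x y; rewrite -g_mono !gh f_mono.
exists h' => [x|y].
- by apply: (inc_inj f_mono); rewrite fh' gh.
- by apply: (inc_inj g_mono); rewrite gh fh'.
Qed.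

Lemma seqprod_le_cat2l d (T : porderType d) (u s t : seqprod T) :
  (u ++ s <= u ++ t :> seqprod T)%O = (s <= t)%O.
Proof. by elim: u => //= x u IHu; rewrite le_cons lexx. Qed.

Lemma seqprod_le_map d d' (T : porderType d) (T' : porderType d')
    (f : T -> T') :
    {mono f : x y / (x <= y)%O} ->
  {mono (map f : seqprod T -> seqprod T') : s t / (s <= t)%O}.
Proof.
by move=> f_mono; elim=> [|x s IHs] [|y t] //=; rewrite !le_cons f_mono IHs.
Qed.

(* In [seqprod], [s <= t] also holds when [s] is below a proper prefix of [t],
   so the order is the componentwise one only between words of equal size. *)
Local Notation word := (seqprod nat).

Definition pad_succ (a : nat) (s : word) : word := nseq a 0 ++ map S s.

Lemma size_pad_succ a s : size (pad_succ a s) = a + size s.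
Proof. by rewrite size_cat size_nseq size_map. Qed.

Lemma pad_succ_le_map_succ a (s t : word) :
  (pad_succ a s <= map S t :> word)%O = (nseq a 0 ++ s <= t :> word)%O.
Proof.
elim: a t => [|a IHa] t; first exact: (@seqprod_le_map _ _ nat nat S).
by case: t => //= x t; exact: IHa.
Qed.

Lemma pad_succ_le a b (s t : word) : a + size s = b + size t ->
  (pad_succ a s <= pad_succ b t)%O
    = (b <= a) && (nseq (a - b) 0 ++ s <= t :> word)%O.
Proof.
move=> eq_size; case: leqP => [le_ba|lt_ab] /=.
  by rewrite -{1}(subnKC le_ba) /pad_succ nseqD -catA seqprod_le_cat2l
             pad_succ_le_map_succ.
have Eb : b = a + (b - a).-1.+1 by lia.
rewrite {1}Eb /pad_succ nseqD -catA seqprod_le_cat2l.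
by case: s eq_size => [|x s] //=; lia.
Qed.

Definition padded_words (W : word -> Prop) (s : word) : Prop :=
  exists a, exists2 t, W t & s = pad_succ a t.

Definition words_of_size (n : nat) (W : word -> Prop) (s : word) : Prop :=
  size s = n /\ W s.

Record word_model d (M : poset_seq d) (W : word -> Prop)
    (e : forall n, M n -> word) : Prop := WordModel {
  word_model_onto n : order_embeds_onto (words_of_size n W) (@e n);
  word_model_step n (x : M n) : e n.+1 (pstep M n x) = 0 :: e n x
}.

Lemma eq_word_model d (M : poset_seq d) W W' (e : forall n, M n -> word) :
  (forall s, W s <-> W' s) -> word_model W e -> word_model W' e.
Proof.
move=> eqW [e_onto e_step]; split=> // n.
by apply: eq_order_embeds_onto (e_onto n) => s; rewrite /words_of_size eqW.
Qed.

Section StackWordModel.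
Variables (d : Order.disp_t) (M : poset_seq d) (W : word -> Prop).
Variable e : forall n, M n -> word.
Hypothesis eM : word_model W e.

Definition stack_word n (u : stack M n) : word :=
  pad_succ (n - tag u) (e (tagged u)).

Lemma word_model_le n : {mono @e n : x y / (x <= y)%O}.
Proof. by case: (word_model_onto eM n). Qed.

Lemma word_model_mem n (x : M n) : words_of_size n W (e x).
Proof. by apply/(word_model_onto eM n).2; exists x. Qed.

Lemma word_model_surj s : W s -> exists x : M (size s), e x = s.
Proof. by move=> Ws; apply/(word_model_onto eM _).2. Qed.

Lemma word_model_push_to j k (le_jk : j <= k) (x : M j) :
  e (push_to le_jk x) = nseq (k - j) 0 ++ e x.
Proof.
have Ek := subnK le_jk; rewrite (push_toE le_jk x Ek).
move: (k - j) Ek => i Ek; case: k / Ek {le_jk} => /=.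
by elim: i => //= i IHi; rewrite (word_model_step eM) IHi.
Qed.

Lemma stack_word_le n : {mono @stack_word n : u v / (u <= v)%O}.
Proof.
move=> [j x] [l y]; rewrite /stack_word /=.
have [le_jn le_ln] := (leq_ord j, leq_ord l).
have [[sz_x _] [sz_y _]] := (word_model_mem x, word_model_mem y).
rewrite pad_succ_le ?sz_x ?sz_y ?subnK //.
have -> : n - j - (n - l) = l - j by lia.
have -> : (n - l <= n - j) = (j <= l) by lia.
apply/andP/le_stackingP => [[le_jl le_xy]|[le_jl]] /=.
  by exists le_jl; rewrite -word_model_le word_model_push_to.
by rewrite -word_model_le word_model_push_to.
Qed.

Lemma stack_word_image n s :
  words_of_size n (padded_words W) s <-> exists u : stack M n, stack_word u = s.
Proof.
split=> [[<- [a [t Wt ->]]]|[[j x] <-]].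
  have [x ex] := word_model_surj Wt; rewrite size_pad_succ.
  have lt_t : size t < (a + size t).+1 by rewrite ltnS leq_addl.
  exists (@stack_elt _ M (a + size t) (Ordinal lt_t) x).
  by rewrite /stack_word /= ex addnK.
have [sz_x Wx] := word_model_mem x; split; last by exists (n - j), (e x).
by rewrite size_pad_succ sz_x subnK // leq_ord.
Qed.

Lemma word_model_stack : word_model (padded_words W) stack_word.
Proof.
split=> [n|n [j x]].
  by split; [exact: stack_word_le | exact: stack_word_image].
by rewrite /stack_word /= subSn // leq_ord.
Qed.

End StackWordModel.

Definition slope_rel (k : nat) : rel nat := fun a b => (b < k) ==> (a <= b).

Definition slope_word (k r : nat) : pred word :=
  fun s => all (geq r) s && sorted (slope_rel k) s.

Lemma slope_word0 r s : slope_word 0 r s = all (geq r) s.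
Proof.
have sorted_s : sorted (slope_rel 0) s by elim: s => //= a [].
by rewrite /slope_word sorted_s andbT.
Qed.

Lemma slope_word_pad_succ k r a s :
  slope_word k.+1 r.+1 (pad_succ a s) = slope_word k r s.
Proof.
rewrite /slope_word all_cat all_nseq orbT all_map.
congr (_ && _); elim: a => [|[|a] IHa] /=; last by rewrite -IHa.
- by rewrite sorted_map; apply: eq_sorted => b c; rewrite /slope_rel /= !ltnS.
- by rewrite -IHa; case: s {IHa} => //= b s; rewrite /slope_rel implybT.
Qed.

Lemma sorted_slope_relS_decomp k s :
  sorted (slope_rel k.+1) s -> exists a t, s = pad_succ a t.
Proof.
elim: s => [|x s IHs] slope_s; first by exists 0, [::].
have [a [t Ds]] := IHs (path_sorted slope_s).
case: x slope_s => [|x] slope_s; first by exists a.+1, t; rewrite Ds.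
case: a Ds => [|a] Ds; first by exists 0, (x :: t); rewrite Ds.
by move: slope_s; rewrite Ds.
Qed.

Lemma slope_wordS k r s :
  slope_word k.+1 r.+1 s <-> padded_words (slope_word k r) s.
Proof.
split=> [slope_s|[a [t slope_t ->]]]; last by rewrite slope_word_pad_succ.
have [a [t Ds]] := sorted_slope_relS_decomp (proj2 (andP slope_s)).
by exists a, t; rewrite // -(slope_word_pad_succ _ _ a) -Ds.
Qed.

Definition ord_word r n (x : chain_pow r n) : word := map val x.

Lemma size_ord_word r n (x : chain_pow r n) : size (ord_word x) = n.
Proof. by rewrite size_map size_tuple. Qed.

Lemma nth_ord_word r n (x : chain_pow r n) (i : 'I_n) :
  nth 0 (ord_word x) i = tnth x i.
Proof. by rewrite (nth_map (tnth x i)) ?size_tuple // -tnth_nth. Qed.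

Lemma all_ord_word r n (x : chain_pow r n) : all (geq r) (ord_word x).
Proof. by rewrite all_map; apply/allP => i _ /=; rewrite -ltnS. Qed.

Lemma ord_word_surj r (s : word) :
  all (geq r) s -> exists x : chain_pow r (size s), ord_word x = s.
Proof.
move=> /allP le_sr; exists (map_tuple inord (in_tuple s)).
rewrite /ord_word /= -map_comp map_id_in // => a /le_sr /= le_ar.
by rewrite inordK.
Qed.

Lemma ord_word_embeds_onto r n :
  order_embeds_onto (words_of_size n (all (geq r))) (@ord_word r n).
Proof.
split=> [x y|s]; first exact: seqprod_le_map.
split=> [[<- /ord_word_surj] //|[x <-]].
by split; [exact: size_ord_word | exact: all_ord_word].
Qed.

Lemma slope_condP k r n (x : chain_pow r n) :
  reflect (forall i s : 'I_n,
             s = i.+1 :> nat -> slope_rel k (tnth x i) (tnth x s))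
          (x \in slope_cond k r n).
Proof.
apply: (iffP 'forall_forallP) => Px i s.
  by move/eqP=> Ds; have := Px i s; rewrite Ds.
by apply/implyP=> /eqP; apply: Px.
Qed.

Lemma slope_word_ord_word k r n (x : chain_pow r n) :
  slope_word k r (ord_word x) = (x \in slope_cond k r n).
Proof.
rewrite /slope_word all_ord_word /=.
apply/(sortedP 0)/slope_condP; rewrite size_ord_word => Px.
  by move=> i s Ds; have := Px i; rewrite -Ds ltn_ord !nth_ord_word; apply.
move=> i lt_i1n; have lt_in := ltnW lt_i1n.
rewrite (nth_ord_word x (Ordinal lt_in)) (nth_ord_word x (Ordinal lt_i1n)).
exact: Px.
Qed.

Lemma slope_poset_embeds_onto k r n :
  order_embeds_onto (words_of_size n (slope_word k r))
    (fun x : slope_poset k r n => ord_word (val x)).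
Proof.
have [ord_word_mono ord_word_im] := ord_word_embeds_onto r n.
split=> [x y|s]; first by rewrite ord_word_mono leEsub.
split=> [[sz_s slope_s]|[x <-]].
  have le_sr : all (geq r) s by case/andP: slope_s.
  have /ord_word_im[x Dx] : words_of_size n (all (geq r)) s by [].
  have Px : x \in slope_cond k r n by rewrite -slope_word_ord_word Dx.
  by exists (exist _ x Px).
by rewrite /words_of_size size_ord_word slope_word_ord_word (valP x).
Qed.

Lemma word_model_chain_pow_seq m :
  @word_model _ (chain_pow_seq m) (slope_word 0 m) (@ord_word m).
Proof.
apply: (@eq_word_model _ _ (all (geq m))) => [s|]; first by rewrite slope_word0.
by split=> // n; apply: ord_word_embeds_onto.
Qed.

Lemma word_model_iter_stack k m :
  exists e,
    @word_model _ (iter_stack k (chain_pow_seq m)) (slope_word k (k + m)) e.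
Proof.
elim: k => [|k [e eM]] /=.
  by exists (@ord_word m); apply: word_model_chain_pow_seq.
exists (stack_word e); apply: eq_word_model (word_model_stack eM) => s.
by rewrite slope_wordS.
Qed.

Lemma slope_rel_minn k a b c d :
  slope_rel k a b -> slope_rel k c d -> slope_rel k (minn a c) (minn b d).
Proof. rewrite /slope_rel; lia. Qed.

Lemma slope_rel_maxn k a b c d :
  slope_rel k a b -> slope_rel k c d -> slope_rel k (maxn a c) (maxn b d).
Proof. rewrite /slope_rel; lia. Qed.

Lemma val_ord_meet r (i j : 'I_r) : (i `&` j)%O = minn i j :> nat.
Proof. by rewrite meetEtotal /Order.min /minn ltEord; case: ifP. Qed.

Lemma val_ord_join r (i j : 'I_r) : (i `|` j)%O = maxn i j :> nat.
Proof. by rewrite joinEtotal /Order.max /maxn ltEord; case: ifP. Qed.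

Lemma slope_cond_sublattice k r n : sublattice (slope_cond k r n).
Proof.
split=> x y /slope_condP Px /slope_condP Py; apply/slope_condP=> i s Ds.
- rewrite !tnth_meet !val_ord_meet.
  by apply: slope_rel_minn; [apply: Px | apply: Py].
- rewrite !tnth_join !val_ord_join.
  by apply: slope_rel_maxn; [apply: Px | apply: Py].
Qed.

Theorem theorem2p1 (k n m : nat) :
  poset_iso (iter_stack k (chain_pow_seq m) n) (slope_poset k (k + m) n)
  /\ sublattice (slope_cond k (k + m) n).
Proof.
split; last exact: slope_cond_sublattice.
have [e eM] := word_model_iter_stack k m.
apply: poset_iso_embeds_onto (word_model_onto eM n) _.
exact: slope_poset_embeds_onto.
Qed.
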